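(* Let $R$ be a finite associative ring and let $I$ be a left ideal of $R$. Then regular elements in $R/I$ can be lifted to regular elements in $R$; that is, for every $x \in R$ for which there exists $y \in R$ with $xyx - x \in I$, there exists a regular element $z \in R$ such that $z - x \in I$.
   Context: Rings are not assumed commutative. An element $z$ of a ring $R$ is called regular (von Neumann regular) if $zwz = z$ for some $w \in R$. Since $I$ is only a left ideal, $x \in R$ is said to represent a regular element of $R/I$ if $xyx - x \in I$ for some $y \in R$. *)

(* Defs.v *)
From HB Require Import structures.
From mathcomp Require Import all_boot all_algebra.

Set Implicit Arguments.
Unset Strict Implicit.
Unset Printing Implicit Defensive.

Import GRing.Theory.
Local Open Scope ring_scope.

(* MathComp's ring structures all have a unit element. Here a ring is only an *)
(* additive group with an associative, biadditive multiplication mul : unital *)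
(* rings, including the zero ring, are covered by taking mul := *%R.          *)
Definition is_ring_mul (R : zmodType) (mul : R -> R -> R) : Prop :=
  [/\ associative mul,
      left_distributive mul (@GRing.add R)
    & right_distributive mul (@GRing.add R)].

(* ring_quotient's idealr_closed would also force the ideal to be proper. *)
Definition is_left_ideal (R : zmodType) (mul : R -> R -> R) (I : {pred R}) :
    Prop :=
  GRing.zmod_closed I /\ (forall a u : R, u \in I -> mul a u \in I).

Definition vn_regular (R : zmodType) (mul : R -> R -> R) (z : R) : Prop :=
  exists w : R, mul (mul z w) z = z.

(* Main.v *)
Require Import Defs.
From mathcomp Require Import all_boot all_algebra.
From mathcomp Require Import zify.

Set Implicit Arguments.
Unset Strict Implicit.
Unset Printing Implicit Defensive.

Import GRing.Theory.
Local Open Scope ring_scope.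

(* Modulo I, left multiplication by a = x y fixes x, so every a^n x lifts the *)
(* class of x. Since R is finite, the sequence a^n x is eventually periodic:  *)
(* a^n x = a^(2n + m + 1) x for some n and m. Then z = a^n x is regular, with *)
(* quasi-inverse w = (y x)^m y, because z w z = a^n a^(m + 1) a^n x.          *)

(** The orbit returns to index [n] with some period [k > 0]. The multiple [(n + 1) * k] is also a
    period and exceeds [n]. *)
Lemma iter_eventually_periodic (T : finType) (f : T -> T) (x : T) :
  exists n m : nat, iter (n + m.+1 + n) f x = iter n f x.
Proof.
have /trajectP[n lt_n loop_n] := looping_order f x.
set k := (order f x - n)%N.
have period j : iter (j * k + n) f x = iter n f x.
  elim: j => // j IHj.
  have -> : (j.+1 * k + n = j * k + order f x)%N.
    by rewrite mulSn addnAC subnK 1?ltnW // addnC.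
  by rewrite iterD loop_n -iterD.
(* This [m] solves [n + m + 1 = (n + 1) * k]; no truncation occurs as [k > 0]. *)
exists n, (n.+1 * k - n.+1)%N.
rewrite -[RHS](period n.+1); congr (iter _ f x).
by have : (n.+1 <= n.+1 * k)%N; [rewrite leq_pmulr // subn_gt0 | lia].
Qed.

(** Powers are iterated left multiplications because [mul] may lack a unit. *)
Lemma iter_mul_assoc (T : Type) (mul : T -> T -> T) (n : nat) (a u v : T) :
  associative mul ->
  mul (iter n (mul a) u) v = iter n (mul a) (mul u v).
Proof. by move=> mulA; elim: n => //= n IHn; rewrite -mulA IHn. Qed.

Lemma iter_mul_shift (T : Type) (mul : T -> T -> T) (n : nat) (x y u : T) :
  associative mul ->
  mul x (iter n (mul (mul y x)) u) = iter n (mul (mul x y)) (mul x u).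
Proof. by move=> mulA; elim: n => //= n IHn; rewrite -IHn !mulA. Qed.

(** Left multiplication by [a] preserves congruence modulo [I], so [a (a^n x)] is congruent to
    [a x], hence to [x]. *)
Lemma iter_mul_sub_left_ideal (R : zmodType) (mul : R -> R -> R)
    (I : {pred R}) (a x : R) (n : nat) :
  is_ring_mul mul -> is_left_ideal mul I -> mul a x - x \in I ->
  iter n (mul a) x - x \in I.
Proof.
move=> [_ _ mulDr] [I_zmod IM] Iax.
have [I0 ID] := GRing.zmod_closedD I_zmod.
elim: n => [|n IHn] /=; first by rewrite subrr.
have -> : mul a (iter n (mul a) x) - x =
    mul a (iter n (mul a) x - x) + (mul a x - x).
  by rewrite addrA -mulDr subrK.
by apply: ID => //; apply: IM.
Qed.

Theorem theorem2p6 (R : finZmodType) (mul : R -> R -> R)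
    (mul_ring : is_ring_mul mul)
    (I : {set R}) (I_left : is_left_ideal mul I)
    (x : R) (x_reg : exists y : R, mul (mul x y) x - x \in I) :
  exists z : R, vn_regular mul z /\ z - x \in I.
Proof.
have [mulA _ _] := mul_ring; have [y Iy] := x_reg.
have [n [m period]] := iter_eventually_periodic (mul (mul x y)) x.
exists (iter n (mul (mul x y)) x); split; last exact: iter_mul_sub_left_ideal.
exists (iter m (mul (mul y x)) y).
rewrite !iter_mul_assoc // iter_mul_shift // iter_mul_assoc //.
(* The leftover factor [x y] is one more application of [a], whence [m + 1]. *)
by rewrite -iterSr -!iterD.
Qed.
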